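(* For all integers $p\geq 5$ and $k\geq \left\lfloor \log_2 (p-1)\right\rfloor$, we have $$g^k_{\left\lfloor \log_2 (p-1)\right\rfloor}(p)\geq 2^k+1.$$
   Context: A Gallai-$k$-coloring of the complete graph $K_n$ is a map $c:E(K_n)\to\{1,\dots,k\}$ (not necessarily surjective) with no rainbow triangle, i.e. every triangle receives at most two distinct colors. For integers $k\ge 1$ and $1\le q\le \binom{p}{2}$, $g^k_q(p)$ denotes the smallest positive integer $n$ such that every Gallai-$k$-coloring of $K_n$ contains a copy of $K_p$ whose edges receive at most $q$ distinct colors. *)

(* Defs.v *)
From mathcomp Require Import all_boot.
From mathcomp Require Import classical_sets.

Set Implicit Arguments.
Unset Strict Implicit.
Unset Printing Implicit Defensive.

(* E(K_n): the 2-element subsets of the vertex set. *)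
Definition edge (n : nat) := {e : {set 'I_n} | #|e| == 2}.

(* Colors received by the edges of the complete subgraph induced by A. *)
Definition colors_on (n k : nat) (c : edge n -> 'I_k) (A : {set 'I_n}) :
    {set 'I_k} :=
  [set c e | e : edge n & val e \subset A].

Definition gallai_coloring (n k : nat) (c : edge n -> 'I_k) : Prop :=
  forall A : {set 'I_n}, #|A| = 3 -> #|colors_on c A| <= 2.

Definition gallai_arrows (k q p n : nat) : Prop :=
  forall c : edge n -> 'I_k, gallai_coloring c ->
    exists2 A : {set 'I_n}, #|A| = p & #|colors_on c A| <= q.

Definition is_gallai_number (k q p n : nat) : Prop :=
  [/\ 0 < n, gallai_arrows k q p n &
      forall m : nat, 0 < m -> gallai_arrows k q p m -> n <= m].

(* g^k_q(p).  The default 0 is returned only if no positive n satisfies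
   gallai_arrows k q p n; since 0 is not positive, a positive lower bound on
   gallai_number entails that the minimum exists. *)
Definition gallai_number (k q p : nat) : nat :=
  xget 0 (is_gallai_number k q p).

(* Main.v *)
Require Import Defs.
From mathcomp Require Import boolp classical_sets.
From mathcomp Require Import all_boot.
From mathcomp Require Import zify.

(**
Put q = floor (log2 (p - 1)), so that 2 ^ q < p.  Label up to 2 ^ k vertices by
distinct words of k bits and color an edge by the first coordinate at which its
two endpoints differ.

- No triangle is rainbow, because first differences are ultrametric: at the
  smallest of the three colors of a triangle the bit takes only two values, so
  it separates two of the three pairs, and the smallest color occurs twice
  ([first_difference_gallai]).
- A clique A whose edges receive the set S of colors has at most 2 ^ |S|
  vertices, because the bits in S already distinguish the vertices of A
  ([first_difference_clique]).  So a clique of size p > 2 ^ q sees more than q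
  colors.

Hence no n <= 2 ^ k has the property that defines the Gallai number
([gallai_arrows_gt]).  To conclude for the number itself one must know that
some n has the property.  As p >= 5 gives q >= 1, a monochromatic clique of
size p is enough, and Ramsey's theorem for k colors provides it
([ramsey], [gallai_arrows_ramsey]).
*)

Set Implicit Arguments.
Unset Strict Implicit.
Unset Printing Implicit Defensive.

(** * Existence of Gallai numbers, from Ramsey's theorem *)

Lemma pigeonhole_color (k : nat) (T : finType) (chi : T -> 'I_k)
    (N : 'I_k -> nat) (A : {set T}) :
  0 < k -> \sum_i N i <= #|A| ->
  exists i, N i <= #|[set y in A | chi y == i]|.
Proof.
move=> k_gt0 leNA; apply/existsP; apply: contraLR leNA.
rewrite negb_exists => /forallP small; rewrite -ltnNge.
have -> : #|A| = \sum_(i < k) #|[set y in A | chi y == i]|.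
  rewrite -sum1_card (partition_big chi predT) //=.
  by apply: eq_bigr => i _; rewrite -sum1_card; apply: eq_bigl => y; rewrite inE.
have : \sum_(i < k) (1 + #|[set y in A | chi y == i]|) <= \sum_i N i.
  by apply: leq_sum => i _; rewrite ltnNge small.
rewrite big_split /= sum_nat_const card_ord; lia.
Qed.

(** Induction on the sum of the targets f.  Fix a vertex x: by pigeonhole, some
    color i joins x to many vertices, and among these the induction hypothesis
    applies with the target of i lowered by one.  Either it produces a clique of
    another color at full size, or a clique of color i one vertex short, which x
    completes.  Coloring all sets, rather than pairs, makes the coloring
    symmetric for free. *)
Lemma ramsey (k : nat) (f : 'I_k -> nat) :
  exists N, forall (T : finType) (chi : {set T} -> 'I_k) (A : {set T}),
    N <= #|A| -> exists i, exists B : {set T}, [/\ B \subset A, #|B| = f i &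
      {in B &, forall x y, x != y -> chi [set x; y] = i}].
Proof.
have [s] := ubnP (\sum_i f i); elim: s f => // s IHs f ltfs.
case: (pickP (fun i => f i == 0)) => [i /eqP fi0 | f_neq0].
  (* A color with target 0 is served by the empty clique. *)
  exists 0 => T chi A _; exists i, set0; split; rewrite ?sub0set ?cards0 //.
  by move=> x y; rewrite inE.
have step i : exists N, forall (T : finType) (chi : {set T} -> 'I_k) (A : {set T}),
    N <= #|A| -> exists j, exists B : {set T},
      [/\ B \subset A, #|B| = f j - (j == i) &
      {in B &, forall x y, x != y -> chi [set x; y] = j}].
  apply: (IHs (fun j => f j - (j == i))).
  move: ltfs; rewrite (bigD1 i) //= [X in _ -> X < _](bigD1 i) //= eqxx.
  rewrite [X in _ -> _ + X < _](eq_bigr f); last by move=> j /negPf ->; rewrite subn0.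
  by have := f_neq0 i; lia.
have [N NP] := fin_all_exists step.
exists (\sum_i N i).+1 => T chi A leNA.
have k_gt0 : 0 < k by exact: leq_ltn_trans (leq0n _) (ltn_ord (chi set0)).
have [x xA] : exists x, x \in A by apply/set0Pn; rewrite -card_gt0; lia.
have leND : \sum_i N i <= #|A :\ x| by move: leNA; rewrite (cardsD1 x A) xA.
have [i /NP] := pigeonhole_color (fun y => chi [set x; y]) k_gt0 leND.
case/(_ chi) => j [B [sBC cardB monoB]].
have inB y : y \in B -> [/\ y != x, y \in A & chi [set x; y] = i].
  by move/(subsetP sBC); rewrite !inE => /andP[/andP[-> ->] /eqP].
have sBA : B \subset A by apply/subsetP => y /inB[].
have [eqji | neqji] := eqVneq j i; last first.
  by exists j, B; split; rewrite // cardB (negPf neqji) subn0.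
exists i, (x |: B); split.
- by rewrite subUset sub1set xA.
- have xB : x \notin B by apply/negP => /inB[]; rewrite eqxx.
  by rewrite cardsU1 xB cardB eqji eqxx; have := f_neq0 i; lia.
move=> y z /setU1P[-> | yB] /setU1P[-> | zB]; first by rewrite eqxx.
- by case: (inB z zB).
- by rewrite setUC; case: (inB y yB).
by move=> neqyz; rewrite (monoB y z).
Qed.

Lemma gallai_arrows_ramsey (k q p : nat) :
  0 < k -> 0 < q -> exists2 n, 0 < n & gallai_arrows k q p n.
Proof.
move=> k_gt0 q_gt0; have [N NP] := ramsey (fun _ : 'I_k => p).
exists N.+1 => // c _.
(* Sets that are not edges get an arbitrary color; the clique never sees it. *)
pose chi (e : {set 'I_N.+1}) := oapp c (Ordinal k_gt0) (insub e).
have [|i [B [_ cardB monoB]]] := NP _ chi [set: 'I_N.+1].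
  by rewrite cardsT card_ord.
exists B => //; apply: leq_trans q_gt0; rewrite -(cards1 i).
apply/subset_leq_card/subsetP => _ /imsetP[e + ->]; rewrite !inE => seB.
have /cards2P[x [y [neqxy def_e]]] := valP e.
have [xB yB] : x \in B /\ y \in B.
  by split; apply: (subsetP seB); rewrite def_e !inE eqxx ?orbT.
by have := monoB x y xB yB neqxy; rewrite /chi -def_e valK /= => ->.
Qed.

(** The default value of [gallai_number] never occurs in this range: some
    positive n is admissible, and the admissible n have a least element. *)
Lemma gallai_numberP (k q p : nat) :
  0 < k -> 0 < q -> is_gallai_number k q p (gallai_number k q p).
Proof.
move=> k_gt0 q_gt0; apply: xgetPex.
have [n n_gt0 arr_n] := gallai_arrows_ramsey p k_gt0 q_gt0.
have ex_n : exists n, (0 < n) && `[< gallai_arrows k q p n >].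
  by exists n; rewrite n_gt0; apply/asboolP.
case: (ex_minnP ex_n) => g /andP[g_gt0 /asboolP arr_g] min_g.
exists g; split=> // m m_gt0 arr_m; apply: min_g; rewrite m_gt0.
exact/asboolP.
Qed.

(** * The first-difference coloring *)

Lemma exists_code (k m : nat) : m <= 2 ^ k ->
  exists f : 'I_m -> {ffun 'I_k -> bool}, injective f.
Proof.
move=> lemk; have le : m <= #|{: {ffun 'I_k -> bool}}|.
  by rewrite card_ffun card_bool card_ord.
exists (fun x => enum_val (widen_ord le x)) => x y /enum_val_inj /(congr1 val) /=.
exact: val_inj.
Qed.

Definition first_difference_coloring (k m : nat) (f : 'I_m -> {ffun 'I_k -> bool})
    (c : edge m -> 'I_k) : Prop :=
  forall (e : edge m) (x y : 'I_m), x \in val e -> y \in val e -> x != y ->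
    f x (c e) != f y (c e) /\ forall j : 'I_k, j < c e -> f x j = f y j.

Lemma exists_first_difference_coloring (k m : nat)
    (f : 'I_m -> {ffun 'I_k -> bool}) :
  injective f -> exists c, first_difference_coloring f c.
Proof.
move=> f_inj; apply: (@fin_all_exists (edge m) (fun=> 'I_k) (fun e i =>
  forall x y, x \in val e -> y \in val e -> x != y ->
    f x i != f y i /\ forall j : 'I_k, j < i -> f x j = f y j)) => e.
have /cards2P[x [y [neqxy ->]]] := valP e.
have [i0 neq0] : exists i, f x i != f y i.
  apply/existsP; apply: contraR neqxy; rewrite negb_exists => /forallP eqf.
  by apply/eqP/f_inj/ffunP => i; apply/eqP; have := eqf i; rewrite negbK.
case: (arg_minnP (P := fun i => f x i != f y i) (fun i : 'I_k => val i) neq0).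
move=> i neqi min_i; exists i.
have below (j : 'I_k) : j < i -> f x j = f y j.
  by move=> ltji; apply/eqP; apply: contraLR ltji => /min_i; rewrite -leqNgt.
move=> u v /set2P[] -> /set2P[] ->; rewrite ?eqxx // => _.
by rewrite eq_sym; split=> // j /below.
Qed.

(** Edges are sets, so each of the three pairs also comes in reversed order. *)
Lemma edge_subset3 (n : nat) (e : edge n) (x y z : 'I_n) :
  val e \subset [set x; y; z] ->
  [\/ val e = [set x; y], val e = [set y; z] | val e = [set x; z]].
Proof.
have /cards2P[u [v [neq ->]]] := valP e; rewrite subUset !sub1set !inE.
move: neq => /[swap] /andP[/orP[/orP[]|] /eqP-> /orP[/orP[]|] /eqP->].
all: rewrite ?eqxx // => _.
all: by [constructor 1 | constructor 2 | constructor 3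
        | constructor 1; rewrite setUC | constructor 2; rewrite setUC
        | constructor 3; rewrite setUC].
Qed.

Lemma exists_edge (n : nat) (x y : 'I_n) :
  x != y -> exists e : edge n, val e = [set x; y].
Proof.
move=> neqxy; have card2 : #|[set x; y]| == 2 by rewrite cards2 neqxy.
by exists (Sub [set x; y] card2); rewrite SubK.
Qed.

(** Among the colors of the three edges of a triangle, a strict minimum is
    impossible: at that coordinate the other two edges would have equal
    endpoints, which forces the third pair to agree there too. *)
Lemma first_difference_gallai (k m : nat) (f : 'I_m -> {ffun 'I_k -> bool})
    (c : edge m -> 'I_k) :
  first_difference_coloring f c -> gallai_coloring c.
Proof.
move=> cP A cardA.
have /set0Pn[z zA] : A != set0 by rewrite -card_gt0 cardA.
have : #|A :\ z| == 2 by move: cardA; rewrite (cardsD1 z A) zA add1n => -[->].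
case/cards2P => x [y [neqxy defA]].
have [neqxz neqyz] : x != z /\ y != z.
  have : (x \in A :\ z) && (y \in A :\ z) by rewrite defA set21 set22.
  by rewrite !inE => /andP[/andP[-> _] /andP[-> _]].
have {}defA : A = [set x; y; z] by rewrite -(setD1K zA) defA setUC.
have [a def_a] := exists_edge neqxy; have [b def_b] := exists_edge neqyz.
have [d def_d] := exists_edge neqxz.
have [] := cP a x y; rewrite ?def_a ?set21 ?set22 // => neq_a eq_a.
have [] := cP b y z; rewrite ?def_b ?set21 ?set22 // => neq_b eq_b.
have [] := cP d x z; rewrite ?def_d ?set21 ?set22 // => neq_d eq_d.
have sub : colors_on c A \subset [set c a; c b; c d].
  apply/subsetP => _ /imsetP[e + ->]; rewrite inE defA => /edge_subset3.
  by rewrite -def_a -def_b -def_d => -[] /val_inj->; rewrite !inE eqxx ?orbT.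
have two : [\/ c a = c b, c a = c d | c b = c d].
  case: (ltngtP (c a) (c b)) => [ltab | ltba | /val_inj]; last by constructor 1.
  - case: (ltngtP (c a) (c d)) => [ltad | ltda | /val_inj]; last by constructor 2.
    + by rewrite eq_d // eq_b // eqxx in neq_a.
    by rewrite eq_a // eq_b ?eqxx // (ltn_trans ltda) in neq_d.
  case: (ltngtP (c b) (c d)) => [ltbd | ltdb | /val_inj]; last by constructor 3.
    by rewrite -eq_a // eq_d // eqxx in neq_b.
  by rewrite eq_a ?eq_b ?eqxx // (ltn_trans ltdb) in neq_d.
apply: leq_trans (subset_leq_card sub) _.
have card_pair (u v : 'I_k) : #|[set u; v]| <= 2 by rewrite cards2; case: (_ != _).
case: two => ->; first by rewrite setUid.
- by rewrite setUAC setUid.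
by rewrite -setUA setUid.
Qed.

(** Two vertices of A differ at the color of the edge that joins them, and this
    color belongs to [colors_on c A]; so the trace of a codeword on these colors
    determines the vertex. *)
Lemma first_difference_clique (k m : nat) (f : 'I_m -> {ffun 'I_k -> bool})
    (c : edge m -> 'I_k) (A : {set 'I_m}) :
  first_difference_coloring f c -> #|A| <= 2 ^ #|colors_on c A|.
Proof.
move=> cP; set S := colors_on c A.
pose trace x := [set i in S | f x i].
have trace_inj : {in A &, injective trace}.
  move=> x y xA yA eq_tr; apply: contraTeq isT => neqxy.
  have [e def_e] := exists_edge neqxy.
  have [] := cP e x y; rewrite ?def_e ?set21 ?set22 // => + _.
  have eS : c e \in S.
    by apply: imset_f; rewrite inE def_e subUset !sub1set xA.
  have := congr1 (fun B : {set 'I_k} => c e \in B) eq_tr.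
  by rewrite !inE eS /= => ->; rewrite eqxx.
rewrite -(card_in_imset trace_inj) -card_powerset; apply: subset_leq_card.
by apply/subsetP => _ /imsetP[x _ ->]; rewrite inE; apply/subsetP => i /setIdP[].
Qed.

(** * The lower bound *)

Lemma gallai_arrows_gt (k q p n : nat) :
  2 ^ q < p -> gallai_arrows k q p n -> 2 ^ k < n.
Proof.
move=> ltqp arrows; rewrite ltnNge; apply/negP => /exists_code[f f_inj].
have [c cP] := exists_first_difference_coloring f_inj.
have [A cardA colA] := arrows c (first_difference_gallai cP).
have := first_difference_clique A cP; rewrite cardA leqNgt => /negP[].
by apply: leq_ltn_trans ltqp; rewrite leq_exp2l.
Qed.

Theorem theorem1p12 (p k : nat) (hp : 5 <= p) (hk : trunc_log 2 (p - 1) <= k) :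
  2 ^ k + 1 <= gallai_number k (trunc_log 2 (p - 1)) p.
Proof.
set q := trunc_log 2 (p - 1) in hk *.
have q_gt0 : 0 < q by rewrite trunc_log_gt0; lia.
have ltqp : 2 ^ q < p by have := @trunc_logP 2 (p - 1) isT; rewrite -/q; lia.
have [_ arrows _] := gallai_numberP p (leq_trans q_gt0 hk) q_gt0.
by rewrite addn1; apply: gallai_arrows_gt arrows.
Qed.
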